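(* Let $R\subset S$ be a ring extension. (1) $R\subset S$ is a Prüfer extension if and only if $R\subset S$ is an integrally closed $\Delta$-extension. (2) If $R\subset S$ is integrally closed and $|\mathrm{Supp}_R(S/R)|<\infty$, then the following conditions are equivalent: (a) $R\subset S$ is a $\Delta$-extension; (b) $R\subset S$ is an FCP extension; (c) $R\subset S$ is an FIP extension.
   Context: All rings are commutative and unital. For a ring extension $R\subseteq S$, $[R,S]$ denotes the set of all $R$-subalgebras of $S$, ordered by inclusion. The extension is integrally closed if $R$ is integrally closed in $S$. It is Prüfer if $R\subseteq T$ is a flat epimorphism of rings for each $T\in[R,S]$ (equivalently, $(R,S)$ is a normal pair, i.e. each $T\in[R,S]$ is integrally closed in $S$). It is a $\Delta$-extension if $T+U\in[R,S]$ for all $T,U\in[R,S]$ (equivalently $T+U=TU$, the compositum). It is FCP if every chain in $[R,S]$ is finite, and FIP if $[R,S]$ is finite. $\mathrm{Supp}_R(S/R)=\{P\in\mathrm{Spec}(R)\mid (S/R)_P\neq0\}$. *)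

(* Defs.v *)
From HB Require Import structures.
From mathcomp Require Import all_boot all_order all_algebra ring.
From mathcomp Require Import generic_quotient ring_quotient.
From mathcomp Require Import boolp classical_sets functions cardinality.

Set Implicit Arguments.
Unset Strict Implicit.
Unset Printing Implicit Defensive.

Import GRing.Theory.
Local Open Scope ring_scope.
Local Open Scope quotient_scope.
Local Open Scope classical_set_scope.

(* [M ⊗_R N] by generators and relations: finite formal sums of pure tensors
   (lists of pairs), modulo the congruence generated by commutativity of the
   sum and bilinearity.  [tens_eq0] supplies the neutral element; opposites
   then come from [(- m, n)]. *)
Section Tensor.
Variables (R : comPzRingType) (M N : lmodType R).

Inductive tens_eq : seq (M * N) -> seq (M * N) -> Prop :=
| tens_eq_refl s : tens_eq s s
| tens_eq_sym s t : tens_eq s t -> tens_eq t s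
| tens_eq_trans s t u : tens_eq s t -> tens_eq t u -> tens_eq s u
| tens_eq_cat s s' t t' :
    tens_eq s s' -> tens_eq t t' -> tens_eq (s ++ t) (s' ++ t')
| tens_eq_catC s t : tens_eq (s ++ t) (t ++ s)
| tens_eqDl m m' n : tens_eq [:: (m + m', n)] [:: (m, n); (m', n)]
| tens_eqDr m n n' : tens_eq [:: (m, n + n')] [:: (m, n); (m, n')]
| tens_eqZ a m n : tens_eq [:: (a *: m, n)] [:: (m, a *: n)]
| tens_eq0 n : tens_eq [:: (0, n)] [::].

Definition tens_eqb (s t : seq (M * N)) : bool := `[< tens_eq s t >].

Lemma tens_eqb_equiv : equiv_class_of tens_eqb.
Proof.
split=> [s|s t|t s u]; first exact/asboolP/tens_eq_refl.
  by apply/asboolP/asboolP; apply: tens_eq_sym.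
by move=> /asboolP st /asboolP tu; apply/asboolP; apply: tens_eq_trans st tu.
Qed.

Canonical tens_eqb_equivRel := EquivRelPack tens_eqb_equiv.
Canonical tens_eqb_encModRel := defaultEncModRel tens_eqb.

Definition tensor := {eq_quot tens_eqb}.
HB.instance Definition _ : EqQuotient _ tens_eqb tensor :=
  EqQuotient.on tensor.
HB.instance Definition _ := Choice.on tensor.

Lemma tensor_piP s t : \pi_tensor s = \pi_tensor t <-> tens_eq s t.
Proof. by split=> [/eqmodP/asboolP|st] //; apply/eqmodP/asboolP. Qed.

Lemma tensorW (P : tensor -> Prop) :
  (forall s, P (\pi_tensor s)) -> forall x, P x.
Proof. by move=> Ps x; rewrite -[x]reprK; apply: Ps. Qed.

Lemma tensor_reprK s : tens_eq (repr (\pi_tensor s)) s.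
Proof. by apply/tensor_piP; rewrite reprK. Qed.

Definition opp_seq (s : seq (M * N)) := [seq (- p.1, p.2) | p <- s].
Definition scale_seq a (s : seq (M * N)) := [seq (a *: p.1, p.2) | p <- s].

Lemma opp_seqE s : opp_seq s = scale_seq (-1) s.
Proof. by apply: eq_map => p; rewrite scaleN1r. Qed.

Lemma scale_seq_eq a s t :
  tens_eq s t -> tens_eq (scale_seq a s) (scale_seq a t).
Proof.
elim=> {s t} /=.
- by move=> s; apply: tens_eq_refl.
- by move=> s t _; apply: tens_eq_sym.
- by move=> s t u _ st _; apply: tens_eq_trans.
- by move=> s s' t t' _ ss _ tt; rewrite /scale_seq !map_cat; apply: tens_eq_cat.
- by move=> s t; rewrite /scale_seq !map_cat; apply: tens_eq_catC.
- by move=> m m' n; rewrite scalerDr; apply: tens_eqDl.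
- by move=> m n n'; apply: tens_eqDr.
- by move=> b m n; rewrite scalerA mulrC -scalerA; apply: tens_eqZ.
- by move=> n; rewrite scaler0; apply: tens_eq0.
Qed.

Definition tensor_zero : tensor := \pi_tensor [::].
Definition tensor_add (x y : tensor) : tensor :=
  \pi_tensor (repr x ++ repr y).
Definition tensor_opp (x : tensor) : tensor := \pi_tensor (opp_seq (repr x)).
Definition tensor_scale a (x : tensor) : tensor :=
  \pi_tensor (scale_seq a (repr x)).

Lemma tensor_addE s t :
  tensor_add (\pi_tensor s) (\pi_tensor t) = \pi_tensor (s ++ t).
Proof. by apply/tensor_piP/tens_eq_cat; apply: tensor_reprK. Qed.

Lemma tensor_scaleE a s : tensor_scale a (\pi_tensor s) = \pi_tensor (scale_seq a s).
Proof. by apply/tensor_piP/scale_seq_eq/tensor_reprK. Qed.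

Lemma tensor_oppE s : tensor_opp (\pi_tensor s) = \pi_tensor (opp_seq s).
Proof.
by apply/tensor_piP; rewrite !opp_seqE; apply/scale_seq_eq/tensor_reprK.
Qed.

Lemma tensor_addA : associative tensor_add.
Proof.
move=> x y z; elim/tensorW: x => s; elim/tensorW: y => t; elim/tensorW: z => u.
by rewrite !tensor_addE catA.
Qed.

Lemma tensor_addC : commutative tensor_add.
Proof.
move=> x y; elim/tensorW: x => s; elim/tensorW: y => t; rewrite !tensor_addE.
exact/tensor_piP/tens_eq_catC.
Qed.

Lemma tensor_add0 : left_id tensor_zero tensor_add.
Proof. by move=> x; elim/tensorW: x => s; rewrite /tensor_zero tensor_addE. Qed.

Lemma tensor_addN : left_inverse tensor_zero tensor_opp tensor_add.
Proof.
move=> x; elim/tensorW: x => s; rewrite tensor_oppE tensor_addE; apply/tensor_piP.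
elim: s => [|[m n] s IHs] /=; first exact: tens_eq_refl.
rewrite -cat1s -[(m, n) :: s]cat1s.
apply: (tens_eq_trans (t := [:: (- m, n)] ++ ([:: (m, n)] ++ (opp_seq s ++ s)))).
  apply: tens_eq_cat; first exact: tens_eq_refl.
  rewrite !catA; apply: tens_eq_cat; last exact: tens_eq_refl.
  exact: tens_eq_catC.
rewrite catA -[[::]]cats0; apply: tens_eq_cat IHs.
apply: tens_eq_trans (tens_eq_sym (tens_eqDl _ _ _)) _.
by rewrite addNr; apply: tens_eq0.
Qed.

HB.instance Definition _ :=
  GRing.isZmodule.Build tensor tensor_addA tensor_addC tensor_add0 tensor_addN.

Lemma tensor_scaleA a b x :
  tensor_scale a (tensor_scale b x) = tensor_scale (a * b) x.
Proof.
elim/tensorW: x => s; rewrite !tensor_scaleE /scale_seq -map_comp.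
by congr (\pi _); apply: eq_map => p /=; rewrite scalerA.
Qed.

Lemma tensor_scale1 : left_id 1 tensor_scale.
Proof.
move=> x; elim/tensorW: x => s; rewrite tensor_scaleE; congr (\pi _).
by rewrite -[RHS]map_id; apply: eq_map => -[m n] /=; rewrite scale1r.
Qed.

Lemma tensor_scaleDr : right_distributive tensor_scale +%R.
Proof.
move=> a x y; elim/tensorW: x => s; elim/tensorW: y => t.
rewrite [\pi_tensor s + _]tensor_addE !tensor_scaleE [RHS]tensor_addE.
by rewrite /scale_seq map_cat.
Qed.

Lemma tensor_scaleDl x : {morph tensor_scale^~ x : a b / a + b}.
Proof.
elim/tensorW: x => s a b; rewrite !tensor_scaleE [RHS]tensor_addE.
apply/tensor_piP; elim: s => [|[m n] s IHs] /=; first exact: tens_eq_refl.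
rewrite scalerDl -cat1s -[X in tens_eq _ X]cat1s.
apply: tens_eq_trans (tens_eq_cat (tens_eqDl _ _ _) IHs) _.
rewrite -cat1s -catA; apply: tens_eq_cat; first exact: tens_eq_refl.
rewrite -[(b *: m, n) :: _ in X in tens_eq _ X]cat1s !catA.
by apply: tens_eq_cat (tens_eq_catC _ _) (tens_eq_refl _).
Qed.

HB.instance Definition _ := GRing.Zmodule_isLmodule.Build R tensor
  tensor_scaleA tensor_scale1 tensor_scaleDr tensor_scaleDl.

Definition pure_tensor (m : M) (n : N) : tensor := \pi_tensor [:: (m, n)].

Lemma pure_tensorDl m m' n :
  pure_tensor (m + m') n = pure_tensor m n + pure_tensor m' n.
Proof. by rewrite [RHS]tensor_addE; apply/tensor_piP/tens_eqDl. Qed.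

Lemma pure_tensorDr m n n' :
  pure_tensor m (n + n') = pure_tensor m n + pure_tensor m n'.
Proof. by rewrite [RHS]tensor_addE; apply/tensor_piP/tens_eqDr. Qed.

Lemma pure_tensorZl a m n : pure_tensor (a *: m) n = a *: pure_tensor m n.
Proof. by rewrite [RHS]tensor_scaleE. Qed.

Lemma pure_tensorZr a m n : pure_tensor m (a *: n) = a *: pure_tensor m n.
Proof. by rewrite -pure_tensorZl; apply/esym/tensor_piP/tens_eqZ. Qed.

Lemma tensor_sum (s : seq (M * N)) :
  \pi_tensor s = \sum_(p <- s) pure_tensor p.1 p.2.
Proof.
elim: s => [|[m n] s IHs]; first by rewrite big_nil.
by rewrite big_cons -IHs [RHS]tensor_addE.
Qed.

Section Lift.
Variables (P : lmodType R) (b : M -> N -> P).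
Hypothesis bDl : forall m m' n, b (m + m') n = b m n + b m' n.
Hypothesis bDr : forall m n n', b m (n + n') = b m n + b m n'.
Hypothesis bZl : forall a m n, b (a *: m) n = a *: b m n.
Hypothesis bZr : forall a m n, b m (a *: n) = a *: b m n.

Lemma tens_eq_sum s t : tens_eq s t ->
  \sum_(p <- s) b p.1 p.2 = \sum_(p <- t) b p.1 p.2.
Proof.
elim=> {s t} //=.
- by move=> s t u _ -> _ ->.
- by move=> s s' t t' _ ss _ tt; rewrite !big_cat /= ss tt.
- by move=> s t; rewrite !big_cat /= addrC.
- by move=> m m' n; rewrite !big_cons big_nil /= !addr0 bDl.
- by move=> m n n'; rewrite !big_cons big_nil /= !addr0 bDr.
- by move=> a m n; rewrite !big_cons big_nil /= !addr0 bZl bZr.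
- by move=> n; rewrite big_cons !big_nil /= addr0 -(scale0r 0) bZl scale0r.
Qed.

Lemma tensor_universal :
  exists2 h : {linear tensor -> P}, forall m n, h (pure_tensor m n) = b m n &
    forall g : {linear tensor -> P},
      (forall m n, g (pure_tensor m n) = b m n) -> g =1 h.
Proof.
pose h (x : tensor) := \sum_(p <- repr x) b p.1 p.2.
have hE s : h (\pi_tensor s) = \sum_(p <- s) b p.1 p.2.
  exact/tens_eq_sum/tensor_reprK.
have h_lin : linear h.
  move=> a x y; elim/tensorW: x => s; elim/tensorW: y => t.
  rewrite [a *: _]tensor_scaleE [_ + _]tensor_addE !hE big_cat /=.
  rewrite /scale_seq big_map scaler_sumr.
  by congr (_ + _); apply: eq_bigr => p _; rewrite bZl.
pose hm := GRing.isLinear.Build R tensor P _ h h_lin.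
pose hl : {linear tensor -> P} := HB.pack h hm.
exists hl => [m n|g gE x]; first by rewrite /= hE big_seq1.
elim/tensorW: x => s; rewrite /= hE tensor_sum raddf_sum.
by apply: eq_bigr => p _; apply: gE.
Qed.
End Lift.

End Tensor.

(* [f ⊗ id_N], computed on a representative; [tensor_mapE] shows that the
   choice is immaterial. *)
Definition tensor_map (R : comPzRingType) (M M' N : lmodType R)
    (f : {linear M -> M'}) (x : tensor M N) : tensor M' N :=
  \pi_(tensor M' N) [seq (f p.1, p.2) | p <- repr x].

Lemma tensor_mapE (R : comPzRingType) (M M' N : lmodType R)
    (f : {linear M -> M'}) (s : seq (M * N)) :
  tensor_map f (\pi_(tensor M N) s) = \sum_(p <- s) pure_tensor (f p.1) p.2.
Proof.
rewrite /tensor_map tensor_sum big_map /=.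
apply: (tens_eq_sum (b := fun m n => pure_tensor (f m) n)).
- by move=> m m' n; rewrite linearD pure_tensorDl.
- by move=> m n n'; rewrite pure_tensorDr.
- by move=> a m n; rewrite linearZ pure_tensorZl.
- by move=> a m n; rewrite pure_tensorZr.
- exact: tensor_reprK.
Qed.

Definition flat (R : comPzRingType) (N : lmodType R) : Prop :=
  forall (M M' : lmodType R) (f : {linear M -> M'}),
    injective f -> injective (tensor_map f : tensor M N -> tensor M' N).

Definition ring_epi (A B : comPzRingType) (h : {rmorphism A -> B}) : Prop :=
  forall (C : comPzRingType) (f g : {rmorphism B -> C}),
    f \o h =1 g \o h -> f =1 g.

Definition flat_epi (R : comNzRingType) (T : comAlgType R) : Prop :=
  flat T /\ ring_epi (in_alg T).

Section QuotientModule.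
Variables (R : pzRingType) (M : lmodType R) (N : submodClosed M).

Let N_zmod : zmodClosed M :=
  HB.pack (GRing.SubmodClosed.sort N)
    (GRing.isZmodClosed.Build M (GRing.SubmodClosed.sort N)
      (GRing.submod_closedB (submodClosedP N))).

Definition quotmod := Quotient.quot N_zmod.
HB.instance Definition _ := EqQuotient.on quotmod.
HB.instance Definition _ := GRing.Zmodule.on quotmod.

Definition quotmod_scale (a : R) (x : quotmod) : quotmod :=
  \pi_quotmod (a *: repr x).

Lemma quotmod_piP (x y : M) :
  \pi_quotmod x = \pi_quotmod y <-> x - y \in N.
Proof.
by split=> [/eqP|xy]; [|apply/eqP]; rewrite -Quotient.idealrBE.
Qed.

Lemma quotmodW (P : quotmod -> Prop) :
  (forall x, P (\pi_quotmod x)) -> forall x, P x.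
Proof. by move=> Px x; rewrite -[x]reprK; apply: Px. Qed.

Lemma quotmod_piD (x y : M) :
  \pi_quotmod (x + y) = \pi_quotmod x + \pi_quotmod y.
Proof. exact: (raddfD (\pi_(Quotient.quot N_zmod))). Qed.

Lemma quotmod_scaleE a x :
  quotmod_scale a (\pi_quotmod x) = \pi_quotmod (a *: x).
Proof.
apply/quotmod_piP; rewrite -scalerBr rpredZ //.
by apply/quotmod_piP; rewrite reprK.
Qed.

Lemma quotmod_scaleA a b x :
  quotmod_scale a (quotmod_scale b x) = quotmod_scale (a * b) x.
Proof. by elim/quotmodW: x => x; rewrite !quotmod_scaleE scalerA. Qed.

Lemma quotmod_scale1 : left_id 1 quotmod_scale.
Proof. by move=> x; elim/quotmodW: x => x; rewrite quotmod_scaleE scale1r. Qed.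

Lemma quotmod_scaleDr : right_distributive quotmod_scale +%R.
Proof.
move=> a x y; elim/quotmodW: x => x; elim/quotmodW: y => y.
by rewrite -quotmod_piD !quotmod_scaleE scalerDr quotmod_piD.
Qed.

Lemma quotmod_scaleDl x : {morph quotmod_scale^~ x : a b / a + b}.
Proof.
by elim/quotmodW: x => x a b; rewrite !quotmod_scaleE scalerDl quotmod_piD.
Qed.

HB.instance Definition _ := GRing.Zmodule_isLmodule.Build R quotmod
  quotmod_scaleA quotmod_scale1 quotmod_scaleDr quotmod_scaleDl.
End QuotientModule.

(* The localization [M_P], as the set of fractions [m / s] with [s] outside
   [P]: [m / s = m' / s'] iff [u (s' m - s m') = 0] for some [u] outside [P]. *)
Section Localization.
Variables (R : comNzRingType) (P : prime_idealr R) (M : lmodType R).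

Definition loc_denom := {s : R | s \notin P}.

Lemma one_notin : 1 \notin P. Proof. by rewrite idealr1. Qed.

Definition loc_eq (x y : M * loc_denom) : bool :=
  `[< exists2 u : R, u \notin P &
        u *: (val y.2 *: x.1 - val x.2 *: y.1) = 0 >].

Lemma loc_eq_equiv : equiv_class_of loc_eq.
Proof.
split=> [x|x y|y x z].
- by apply/asboolP; exists 1; rewrite ?one_notin // subrr scaler0.
- by apply/asboolP/asboolP=> -[u uP ux]; exists u => //;
    rewrite -opprB scalerN ux oppr0.
move=> /asboolP[u uP /eqP]; rewrite scalerBr subr_eq0 => /eqP ux.
move=> /asboolP[v vP /eqP]; rewrite scalerBr subr_eq0 => /eqP vy.
apply/asboolP; exists (u * v * val y.2).
  by rewrite !prime_idealrM !negb_or uP vP (valP y.2).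
apply/eqP; rewrite scalerBr subr_eq0; apply/eqP.
move: ux vy; rewrite !scalerA => ux vy.
have -> : u * v * val y.2 * val z.2 = v * val z.2 * (u * val y.2).
  by ring.
rewrite -[LHS]scalerA ux scalerA.
have -> : v * val z.2 * (u * val x.2) = u * val x.2 * (v * val z.2).
  by rewrite mulrC.
rewrite -[LHS]scalerA vy scalerA; congr (_ *: _).
by ring.
Qed.

Canonical loc_eq_equivRel := EquivRelPack loc_eq_equiv.
Canonical loc_eq_encModRel := defaultEncModRel loc_eq.

Definition locmod := {eq_quot loc_eq}.

Definition loc_frac (m : M) (s : loc_denom) : locmod :=
  \pi_{eq_quot loc_eq} (m, s).

Definition locmod_nonzero : Prop :=
  exists x : locmod, x <> loc_frac 0 (Sub 1 one_notin).
End Localization.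

(* [prime_idealr R] lists the primes as boolean predicates, which are classically
   the same as subsets; the support is a set of such subsets of [R]. *)
Definition supp (R : comNzRingType) (M : lmodType R) : set (set R) :=
  [set A | exists2 P : prime_idealr R,
     A = [set x | x \in P] & locmod_nonzero P M].

Section Subalgebra.
Variables (R : comNzRingType) (S : comAlgType R) (T : subalgClosed S).
Definition subalg := {x : S | x \in T}.
HB.instance Definition _ := SubChoice.on subalg.
HB.instance Definition _ := GRing.SubChoice_isSubAlgebra.Build R S
  (GRing.SubalgClosed.sort T) subalg (GRing.subalg_closed_semi (subalgClosedP T)).
HB.instance Definition _ := [SubNzRing_isSubComNzRing of subalg by <:].
End Subalgebra.

(* An extension [R ⊆ S] is given by a commutative [R]-algebra [S] whose structure
   map [in_alg S] is injective. *)
Section Extension.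
Variables (R : comNzRingType) (S : comAlgType R).

(* [[R, S]], each [R]-subalgebra being recorded as its underlying subset. *)
Definition intermediate : set (set S) :=
  [set A | exists T : subalgClosed S, A = [set x | x \in T]].

(* The image of [R] in [S]. *)
Definition base : {pred S} := [pred x | `[< exists a : R, x = a%:A >]].

Lemma base_submod : GRing.submod_closed base.
Proof.
split=> [|a _ _ /asboolP[b ->] /asboolP[c ->]]; apply/asboolP.
  by exists 0; rewrite scale0r.
by exists (a * b + c); rewrite scalerDl scalerA.
Qed.

HB.instance Definition _ := GRing.isSubmodClosed.Build R S base
  (GRing.submod_closed_semi base_submod).

(* The [R]-module [S / R]. *)
Definition ext_quot : lmodType R := quotmod base.

Definition integrally_closed : Prop :=
  forall x : S, integralOver (in_alg S) x -> x \in base.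

Definition prufer : Prop := forall T : subalgClosed S, flat_epi (subalg T).

Definition delta_extension : Prop :=
  forall T U : set S, intermediate T -> intermediate U ->
    intermediate [set t + u | t in T & u in U].

Definition fcp : Prop :=
  forall C : set (set S),
    C `<=` intermediate -> total_on C subset -> finite_set C.

Definition fip : Prop := finite_set intermediate.

End Extension.

Arguments intermediate {R} S.
Arguments base {R} S.
Arguments ext_quot {R} S.
Arguments integrally_closed {R} S.
Arguments prufer {R} S.
Arguments delta_extension {R} S.
Arguments fcp {R} S.
Arguments fip {R} S.

(* Main.v *)
(* An algebra [T] in [[R, S]] is a flat epimorphism iff [(R : t) T = T] for all
   [t] in [T].  From this, [R] in [S] is Pruefer iff
     [1] lies in [(R : x) + x (R : x)] for all [x] in [S],
   which says that locally [x] or [1 / x] belongs to [R].  When [R] is integrally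
   closed in [S], the coefficients of any polynomial relation satisfied by [x] lie
   in [(R : x) + x (R : x)]; so one relation with a coefficient equal to [1] is
   enough, and both the Delta property (applied to [R[x^2]] and [R[x^3]]) and FCP
   (applied to the chain of the [R[x^(2^k)]]) provide such a relation. *)
Require Import Defs.
From mathcomp Require Import all_boot all_algebra.
From mathcomp Require Import classical_sets cardinality.
From HB Require Import structures.
From mathcomp Require Import boolp generic_quotient ring_quotient ring.

Set Implicit Arguments.
Unset Strict Implicit.
Unset Printing Implicit Defensive.

Import GRing.Theory.
Local Open Scope ring_scope.
Local Open Scope quotient_scope.
Local Open Scope classical_set_scope.
Local Open Scope card_scope.

(** * The ring [A (x) A] and epimorphisms *)

Lemma pure_tensor0l (R : comPzRingType) (M N : lmodType R) (n : N) :
  pure_tensor (0 : M) n = 0.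
Proof. by rewrite -[X in pure_tensor X](scale0r 0) pure_tensorZl scale0r. Qed.

Lemma pure_tensor0r (R : comPzRingType) (M N : lmodType R) (m : M) :
  pure_tensor m (0 : N) = 0.
Proof. by rewrite -[X in pure_tensor _ X](scale0r 0) pure_tensorZr scale0r. Qed.

Section TensorRing.
Variables (R : comNzRingType) (A : comAlgType R).

(** A separate name for [tensor A A], which carries its ring structure. *)
Definition tensor_sq : Type := tensor A A.
HB.instance Definition _ := GRing.Zmodule.on tensor_sq.

Implicit Types (s t u : seq (A * A)) (x y z : tensor_sq).

Definition tensor_sq_of s : tensor_sq := \pi_(tensor A A) s.

Definition mul_seq s t := [seq (p.1 * q.1, p.2 * q.2) | p <- s, q <- t].

Definition tensor_sq_one : tensor_sq := pure_tensor 1 1.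
Definition tensor_sq_mul x y : tensor_sq :=
  tensor_sq_of (mul_seq (repr (x : tensor A A)) (repr (y : tensor A A))).

Lemma tensor_sqW (P : tensor_sq -> Prop) :
  (forall s, P (tensor_sq_of s)) -> forall x, P x.
Proof. by move=> Ps x; elim/tensorW: x. Qed.

Lemma tensor_sq_ofD s t :
  tensor_sq_of s + tensor_sq_of t = tensor_sq_of (s ++ t).
Proof. exact: tensor_addE. Qed.

Lemma tensor_sq_of_mul s t : tensor_sq_of (mul_seq s t) =
  \sum_(p <- s) \sum_(q <- t) (pure_tensor (p.1 * q.1) (p.2 * q.2) : tensor_sq).
Proof. by rewrite [LHS]tensor_sum big_allpairs_dep. Qed.

(** The double sum is bilinear in the pure tensors of each factor, so [tens_eq_sum] replaces the
    chosen representatives by [s] and [t], one factor at a time. *)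
Lemma tensor_sq_mulE s t :
  tensor_sq_mul (tensor_sq_of s) (tensor_sq_of t) = tensor_sq_of (mul_seq s t).
Proof.
rewrite /tensor_sq_mul !tensor_sq_of_mul.
set s' := repr _; set t' := repr _.
transitivity (\sum_(p <- s) \sum_(q <- t')
    (pure_tensor (p.1 * q.1) (p.2 * q.2) : tensor_sq)).
  apply: (@tens_eq_sum _ _ _ (tensor A A) (fun m n =>
    \sum_(q <- t') pure_tensor (m * q.1) (n * q.2))); last exact: tensor_reprK.
  - by move=> m m' n; rewrite -big_split; apply: eq_bigr => q _;
      rewrite mulrDl pure_tensorDl.
  - by move=> m m' n; rewrite -big_split; apply: eq_bigr => q _;
      rewrite mulrDl pure_tensorDr.
  - by move=> a m n; rewrite scaler_sumr; apply: eq_bigr => q _;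
      rewrite -scalerAl pure_tensorZl.
  - by move=> a m n; rewrite scaler_sumr; apply: eq_bigr => q _;
      rewrite -scalerAl pure_tensorZr.
apply: eq_bigr => p _.
apply: (@tens_eq_sum _ _ _ (tensor A A) (fun m n =>
  pure_tensor (p.1 * m) (p.2 * n))); last exact: tensor_reprK.
- by move=> m m' n; rewrite mulrDr pure_tensorDl.
- by move=> m m' n; rewrite mulrDr pure_tensorDr.
- by move=> a m n; rewrite -scalerAr pure_tensorZl.
- by move=> a m n; rewrite -scalerAr pure_tensorZr.
Qed.

Lemma tensor_sq_mulA : associative tensor_sq_mul.
Proof.
move=> x y z; elim/tensor_sqW: x => s; elim/tensor_sqW: y => t.
elim/tensor_sqW: z => u; rewrite !tensor_sq_mulE !tensor_sq_of_mul.
rewrite big_allpairs_dep; apply: eq_bigr => p _.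
rewrite big_allpairs_dep; apply: eq_bigr => q _.
by apply: eq_bigr => r _; rewrite !mulrA.
Qed.

Lemma tensor_sq_mulC : commutative tensor_sq_mul.
Proof.
move=> x y; elim/tensor_sqW: x => s; elim/tensor_sqW: y => t.
rewrite !tensor_sq_mulE !tensor_sq_of_mul exchange_big /=.
by apply: eq_bigr => p _; apply: eq_bigr => q _; rewrite mulrC [p.2 * _]mulrC.
Qed.

Lemma tensor_sq_mul1 : left_id tensor_sq_one tensor_sq_mul.
Proof.
move=> x; elim/tensor_sqW: x => s.
rewrite [LHS]tensor_sq_mulE; congr tensor_sq_of.
by rewrite /mul_seq /= cats0 -[RHS]map_id; apply: eq_map => -[m n] /=; rewrite !mul1r.
Qed.

Lemma tensor_sq_mulDl : left_distributive tensor_sq_mul +%R.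
Proof.
move=> x y z; elim/tensor_sqW: x => s; elim/tensor_sqW: y => t.
elim/tensor_sqW: z => u.
by rewrite tensor_sq_ofD !tensor_sq_mulE !tensor_sq_of_mul big_cat.
Qed.

HB.instance Definition _ := GRing.Zmodule_isComPzRing.Build tensor_sq
  tensor_sq_mulA tensor_sq_mulC tensor_sq_mul1 tensor_sq_mulDl.

Lemma tensor_sq_pureM m n m' n' :
  (pure_tensor m n : tensor_sq) * pure_tensor m' n' =
  pure_tensor (m * m') (n * n').
Proof. by rewrite [LHS]tensor_sq_mulE. Qed.

Definition tensor_inl (m : A) : tensor_sq := pure_tensor m 1.
Definition tensor_inr (n : A) : tensor_sq := pure_tensor 1 n.

Lemma tensor_inl_zmod : zmod_morphism tensor_inl.
Proof.
by move=> m n; rewrite /tensor_inl -scaleN1r pure_tensorDl pure_tensorZl scaleN1r.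
Qed.

Lemma tensor_inr_zmod : zmod_morphism tensor_inr.
Proof.
by move=> m n; rewrite /tensor_inr -scaleN1r pure_tensorDr pure_tensorZr scaleN1r.
Qed.

Lemma tensor_inl_monoid : monoid_morphism tensor_inl.
Proof. by split=> // m n; rewrite tensor_sq_pureM mulr1. Qed.

Lemma tensor_inr_monoid : monoid_morphism tensor_inr.
Proof. by split=> // m n; rewrite tensor_sq_pureM mulr1. Qed.

HB.instance Definition _ :=
  GRing.isZmodMorphism.Build A tensor_sq tensor_inl tensor_inl_zmod.
HB.instance Definition _ :=
  GRing.isMonoidMorphism.Build A tensor_sq tensor_inl tensor_inl_monoid.
HB.instance Definition _ :=
  GRing.isZmodMorphism.Build A tensor_sq tensor_inr tensor_inr_zmod.
HB.instance Definition _ :=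
  GRing.isMonoidMorphism.Build A tensor_sq tensor_inr tensor_inr_monoid.

(** The two canonical maps from [A] to [A (x) A] agree on the image of [R], so an epimorphism forces
    them to be equal. *)
Lemma epi_tensor : ring_epi (in_alg A) ->
  forall t : A, pure_tensor t 1 = pure_tensor 1 t :> tensor A A.
Proof.
move=> /(_ tensor_sq tensor_inl tensor_inr) epi t; apply: epi => a /=.
by rewrite /tensor_inl /tensor_inr pure_tensorZl pure_tensorZr.
Qed.

End TensorRing.

(** * Extended ideals, conductors [(R : t)], and their behaviour in flat epimorphisms *)

Lemma quotmod_pi_linear (R : comNzRingType) (M : lmodType R) (N : submodClosed M) :
  linear (\pi_(quotmod N) : M -> quotmod N).
Proof.
move=> a x y; rewrite quotmod_piD; congr (_ + _).
exact/esym/quotmod_scaleE.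
Qed.

Lemma quotmod_pi0 (R : comNzRingType) (M : lmodType R) (N : submodClosed M) :
  \pi_(quotmod N) 0 = 0.
Proof.
by rewrite -[RHS](scale0r 0) -[in RHS](reprK 0) [RHS]quotmod_scaleE scale0r.
Qed.

Section IdealSpan.
Variables (R : comNzRingType) (A : comAlgType R).
Implicit Types (I J K : set R) (T U : set A) (x y z t : A).

(** For an ideal [I] and a subalgebra [T] this is the extended ideal [I T]. Plain sets are allowed,
    so that a generating set such as a union can be used directly. *)
Inductive ideal_span I T : A -> Prop :=
| ideal_span0 : ideal_span I T 0
| ideal_span_cons a t z of I a & T t & ideal_span I T z :
    ideal_span I T (a *: t + z).

Lemma ideal_span_mem I T a t : I a -> T t -> ideal_span I T (a *: t).
Proof.
by move=> Ia Tt; rewrite -[_ *: _]addr0; apply: ideal_span_cons => //; left.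
Qed.

Lemma ideal_spanD I T y z :
  ideal_span I T y -> ideal_span I T z -> ideal_span I T (y + z).
Proof.
move=> + Iz; elim=> [|a t w Ia Tt _ IH]; first by rewrite add0r.
by rewrite -addrA; apply: ideal_span_cons.
Qed.

Lemma ideal_span_bind I T J U : (forall a t, I a -> T t -> ideal_span J U (a *: t)) ->
  ideal_span I T `<=` ideal_span J U.
Proof.
move=> IJ z; elim=> [|a t w Ia Tt _ IH]; first by left.
by apply: ideal_spanD => //; apply: IJ.
Qed.

Lemma ideal_spanS I J T : I `<=` J -> ideal_span I T `<=` ideal_span J T.
Proof.
move=> IJ; apply: ideal_span_bind => a t Ia Tt.
by apply: ideal_span_mem => //; apply: IJ.
Qed.

Lemma ideal_spanMl I T t z : (forall u, T u -> T (t * u)) ->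
  ideal_span I T z -> ideal_span I T (t * z).
Proof.
move=> TM; elim=> [|a u w Ia Tu _ IH]; first by rewrite mulr0; left.
by rewrite mulrDr -scalerAr; apply: ideal_span_cons => //; apply: TM.
Qed.

Lemma ideal_spanM I J K T y z :
    (forall t u, T t -> T u -> T (t * u)) ->
    (forall a b, I a -> J b -> K (a * b)) ->
  ideal_span I T y -> ideal_span J T z -> ideal_span K T (y * z).
Proof.
move=> TM IJK + Jz; elim=> [|a t w Ia Tt _ IH]; first by rewrite mul0r; left.
rewrite mulrDl; apply: ideal_spanD => //.
elim: Jz => [|b u v Jb Tu _ IHv]; first by rewrite mulr0; left.
rewrite mulrDr; apply: ideal_spanD => //.
rewrite -scalerAl -scalerAr scalerA; apply: ideal_span_mem; first exact: IJK.
exact: TM.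
Qed.

Definition colon t : set R := [set a | a *: t \in base A].

Lemma base_inP x : reflect (exists a : R, x = a%:A) (x \in base A).
Proof. exact: asboolP. Qed.

Lemma base_alg (a : R) : a%:A \in base A. Proof. by apply/base_inP; exists a. Qed.

Lemma base_mul x y : x \in base A -> y \in base A -> x * y \in base A.
Proof.
by move=> /base_inP[a ->] /base_inP[b ->]; rewrite mulr_algl scalerA base_alg.
Qed.

Lemma colonM t a b : colon t b -> colon t (a * b).
Proof. by rewrite /colon /= -scalerA => tb; rewrite rpredZ. Qed.

(** [R^o] is [R] as a module over itself; in this form [(R : t)] is a submodule by which [quotmod]
    can divide. *)
Definition colonb t : {pred R^o} := fun a => `[< colon t a >].

Lemma colon_submod t : GRing.submod_closed (colonb t).
Proof.
split=> [|a u v /asboolP tu /asboolP tv]; apply/asboolP.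
  by rewrite /colon /= scale0r rpred0.
by rewrite /colon /= scalerDl rpredD // -scalerA rpredZ.
Qed.

HB.instance Definition _ t := GRing.isSubmodClosed.Build R R^o (colonb t)
  (GRing.submod_closed_semi (colon_submod t)).

Definition ideal_spanb I : {pred A} := fun z => `[< ideal_span I setT z >].

Lemma ideal_span_submod I : GRing.submod_closed (ideal_spanb I).
Proof.
split=> [|a u v /asboolP Iu /asboolP Iv]; apply/asboolP; first by left.
apply: ideal_spanD => //; rewrite -[a *: u]mulr_algl.
exact: ideal_spanMl.
Qed.

HB.instance Definition _ I := GRing.isSubmodClosed.Build R A (ideal_spanb I)
  (GRing.submod_closed_semi (ideal_span_submod I)).

(* Tensoring the injection [R / (R : t) -> A / R], [1 |-> t], with the flat
   module [A] gives an injection on [A / (R : t) A], and this injection is zero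
   because [t (x) 1 = 1 (x) t]. *)
Lemma flat_epi_colon (t : A) : flat_epi A -> ideal_span (colon t) setT 1.
Proof.
case=> flatA /epi_tensor epiA.
pose I : submodClosed R^o := colonb t.
pose IA : submodClosed A := ideal_spanb (colon t).
have piI (a b : R^o) : \pi_(quotmod I) a = \pi_(quotmod I) b <-> colon t (a - b).
  by split=> [/quotmod_piP/asboolP|ab] //; apply/quotmod_piP/asboolP.
have piIA (y z : A) :
    \pi_(quotmod IA) y = \pi_(quotmod IA) z <-> ideal_span (colon t) setT (y - z).
  by split=> [/quotmod_piP/asboolP|ab] //; apply/quotmod_piP/asboolP.
pose f (x : quotmod I) : ext_quot A := \pi_(ext_quot A) ((repr x : R) *: t).
have fE (a : R^o) : f (\pi_(quotmod I) a) = \pi_(ext_quot A) ((a : R) *: t).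
  apply/quotmod_piP; rewrite -scalerBl.
  by have /piI := reprK (\pi_(quotmod I) a).
have f_lin : linear f.
  move=> a x y; elim/quotmodW: x => x; elim/quotmodW: y => y.
  by rewrite -quotmod_pi_linear !fE -quotmod_pi_linear scalerDl scalerA.
pose fl : {linear quotmod I -> ext_quot A} :=
  HB.pack f (GRing.isLinear.Build _ _ _ _ f f_lin).
have f_inj : injective fl.
  move=> x y; elim/quotmodW: x => x; elim/quotmodW: y => y.
  rewrite /= !fE => /quotmod_piP; rewrite -scalerBl => xy.
  exact/piI.
pose p : {linear A -> ext_quot A} :=
  HB.pack (\pi_(ext_quot A) : A -> ext_quot A)
   (GRing.isLinear.Build _ _ _ _ (\pi_(ext_quot A) : A -> ext_quot A)
     (@quotmod_pi_linear R A (base A))).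
have p1 : p 1 = 0.
  rewrite -[RHS](linear0 p); apply/quotmod_piP.
  by rewrite subr0 -[1]scale1r base_alg.
have t0 : pure_tensor (p t) 1 = 0 :> tensor (ext_quot A) A.
  have := congr1 (tensor_map p) (epiA t).
  rewrite [LHS]tensor_mapE [RHS]tensor_mapE !big_seq1 => -> /=.
  by rewrite -[X in pure_tensor X]/(p 1) p1 pure_tensor0l.
have u0 : pure_tensor (\pi_(quotmod I) (1 : R^o)) 1 = 0 :> tensor (quotmod I) A.
  apply: (flatA _ _ fl f_inj); rewrite /pure_tensor tensor_mapE big_seq1 /=.
  rewrite fE scale1r [LHS]t0.
  by have := tensor_mapE (N := A) fl [::]; rewrite big_nil => <-.
(* This bilinear map induces the canonical map from [R / (R : t) (x) A] to [A / (R : t) A]. It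
   carries [1 (x) 1], which is zero by [u0], to the class of 1. *)
pose b (x : quotmod I) (z : A) : quotmod IA := \pi_(quotmod IA) ((repr x : R) *: z).
have bE (a : R^o) z : b (\pi_(quotmod I) a) z = \pi_(quotmod IA) ((a : R) *: z).
  apply/piIA; rewrite -scalerBl.
  by apply: ideal_span_mem => //; have /piI := reprK (\pi_(quotmod I) a).
have [||||h hE _] := @tensor_universal _ (quotmod I) A (quotmod IA) b.
- move=> x y z; elim/quotmodW: x => x; elim/quotmodW: y => y.
  by rewrite -quotmod_piD !bE scalerDl quotmod_piD.
- by move=> x z w; elim/quotmodW: x => x; rewrite !bE scalerDr quotmod_piD.
- move=> a x z; elim/quotmodW: x => x.
  by rewrite [a *: _]quotmod_scaleE !bE [RHS]quotmod_scaleE scalerA.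
- move=> a x z; elim/quotmodW: x => x.
  by rewrite !bE [RHS]quotmod_scaleE !scalerA mulrC.
have := hE (\pi_(quotmod I) (1 : R^o)) 1.
rewrite u0 linear0 bE scale1r => /esym.
by rewrite -quotmod_pi0 => /piIA; rewrite subr0.
Qed.

End IdealSpan.

(** * The converse: [(R : t) A = A] for all [t] makes [A] a flat epimorphism *)

Section FlatEpi.
Variables (R : comNzRingType) (A : comAlgType R).
Hypothesis A_inj : injective (in_alg A).
Hypothesis A_colon : forall t : A, ideal_span (colon t) setT (1 : A).
Implicit Types (I J : set R) (x y z t : A).

(** For [a] in [(R : t)], [f t * f a = f (a t) = g (a t) = g t * f a], as [f] and [g] agree on [R].
    Hence [f t - g t] is killed by [f a] for all these [a], and 1 is a combination of them. *)
Lemma colon_ring_epi : ring_epi (in_alg A).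
Proof.
move=> C f g fg t; apply/eqP.
rewrite -subr_eq0 -[_ - _]mul1r -(rmorph1 f); apply/eqP.
elim: (A_colon t) => [|a u z /base_inP[b ab] _ _ IH]; first by rewrite raddf0 mul0r.
rewrite rmorphD mulrDl IH addr0 -mulr_algl mulrC rmorphM mulrA mulrBl.
have fga c : f c%:A = g c%:A by apply: fg.
have -> : f t * f a%:A = f b%:A by rewrite -rmorphM mulr_algr ab.
have -> : g t * f a%:A = f b%:A by rewrite fga -rmorphM mulr_algr ab fga.
by rewrite subrr mul0r.
Qed.

(** These sets satisfy [J A = A]. They are stable under intersection, so finitely many conditions on
    denominators can be imposed at once. *)
Definition dense J :=
  (forall a b, J b -> J (a * b)) /\ ideal_span J setT (1 : A).

Lemma denseI I J : dense I -> dense J -> dense (I `&` J).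
Proof.
move=> [IM I1] [JM J1]; split=> [a b [/IM ? /JM ?]//|].
rewrite -[1]mulr1; apply: ideal_spanM I1 J1 => // a b Ia Jb.
by split; [rewrite mulrC; apply: IM | apply: JM].
Qed.

Lemma denseT : dense setT.
Proof.
by split=> //; rewrite -[X in ideal_span _ _ X]scale1r; apply: ideal_span_mem.
Qed.

(** The common denominators of the second components of a formal sum of tensors. *)
Definition denoms (M : choiceType) (s : seq (M * A)) : set R :=
  [set a | forall p, p \in s -> colon p.2 a].

Lemma denoms_dense (M : choiceType) (s : seq (M * A)) : dense (denoms s).
Proof.
elim: s => [|q s IHs].
  by have := denseT; congr dense; apply/seteqP; split.
have -> : denoms (q :: s) = colon q.2 `&` denoms s.
  apply/seteqP; split=> [a sa|a [qa sa] p].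
    by split=> [|p ps]; apply: sa; rewrite inE ?eqxx ?ps ?orbT.
  by rewrite inE => /orP[/eqP->|/sa].
by apply: denseI => //; split=> // a b; apply: colonM.
Qed.

Lemma denoms_cat (M : choiceType) (s t : seq (M * A)) a :
  denoms (s ++ t) a <-> denoms s a /\ denoms t a.
Proof.
split=> [H|[sa ta] p]; last by rewrite mem_cat => /orP[/sa|/ta].
by split=> p pt; apply: H; rewrite mem_cat pt ?orbT.
Qed.

(* The inverse of [in_alg A] on its image, with junk value [0] elsewhere. *)
Definition numer x : R := xget 0 [set r | x = r%:A].

Lemma numerK x : x \in base A -> (numer x)%:A = x.
Proof.
move=> /base_inP[r xr].
have : [set r | x = r%:A] (numer x) by apply: xgetPex; exists r.
by move=> /= <-.
Qed.

Lemma numer_alg r : numer r%:A = r.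
Proof. by apply/A_inj/numerK/base_alg. Qed.

Lemma numerD x y : x \in base A -> y \in base A ->
  numer (x + y) = numer x + numer y.
Proof.
by move=> /base_inP[r ->] /base_inP[s ->]; rewrite -scalerDl !numer_alg.
Qed.

Lemma numerZ a x : x \in base A -> numer (a *: x) = a * numer x.
Proof. by move=> /base_inP[r ->]; rewrite scalerA !numer_alg. Qed.

(** For a common denominator [a], each [a n] moves across the tensor sign as a scalar. This is the
    element of [M] left on the other side of [1]. *)
Definition numer_sum (M : lmodType R) a (s : seq (M * A)) : M :=
  \sum_(p <- s) numer (a *: p.2) *: p.1.

Lemma numer_sum_pure (M : lmodType R) a (s : seq (M * A)) :
  denoms s a -> a *: \pi_(tensor M A) s = pure_tensor (numer_sum a s) 1.
Proof.
rewrite tensor_sum /numer_sum; elim: s => [_|q s IHs].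
  by rewrite !big_nil scaler0 pure_tensor0l.
rewrite -cat1s => /denoms_cat[qa sa].
rewrite !big_cat !big_seq1 scalerDr {}IHs // [RHS]pure_tensorDl; congr (_ + _).
rewrite pure_tensorZl -pure_tensorZr numerK ?pure_tensorZr //.
by apply: qa; rewrite mem_seq1.
Qed.

(* A relation in [M (x) A] becomes a relation in [M] after multiplication by
   suitable common denominators. *)
Lemma tens_eq_numer (M : lmodType R) (s t : seq (M * A)) : tens_eq s t ->
  exists2 J, dense J &
    forall a, J a -> denoms s a -> denoms t a -> numer_sum a s = numer_sum a t.
Proof.
rewrite /numer_sum; elim=> {s t}.
- by move=> s; exists setT => //; apply: denseT.
- by move=> s t _ [J dJ JE]; exists J => // a Ja sa ta; rewrite JE.
- move=> s t u _ [J dJ JE] _ [K dK KE].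
  (* The middle term [t] does not appear in the conclusion, so that [a] is a denominator for it has
     to be part of the dense set. *)
  exists (J `&` K `&` denoms t).
    by apply: denseI (denoms_dense t); apply: denseI.
  by move=> a [[Ja Ka] ta] sa ua; rewrite JE ?KE.
- move=> s s' t t' _ [J dJ JE] _ [K dK KE]; exists (J `&` K); first exact: denseI.
  move=> a [Ja Ka] /denoms_cat[sa ta] /denoms_cat[sa' ta'].
  by rewrite !big_cat /= JE ?KE.
- move=> s t; exists setT; first exact: denseT.
  by move=> a _ _ _; rewrite !big_cat /= addrC.
- move=> m m' n; exists setT; first exact: denseT.
  by move=> a _ _ _; rewrite !big_cons big_nil /= !addr0 scalerDr.
- move=> m n n'; exists setT; first exact: denseT.
  move=> a _ _ Ha; rewrite !big_cons big_nil /= !addr0 scalerDr.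
  have an : a *: n \in base A by apply: (Ha (m, n)); rewrite mem_head.
  have an' : a *: n' \in base A by apply: (Ha (m, n')); rewrite !inE eqxx orbT.
  by rewrite numerD // scalerDl.
- move=> c m n; exists setT; first exact: denseT.
  move=> a _ Ha _; rewrite !big_cons big_nil /= !addr0.
  have an : a *: n \in base A by apply: (Ha (c *: m, n)); rewrite mem_head.
  by rewrite !scalerA mulrC -numerZ // scalerA mulrC.
- move=> n; exists setT; first exact: denseT.
  by move=> a _ _ _; rewrite big_seq1 big_nil scaler0.
Qed.

(** Write 1 as a sum of products [a t] with [a] in [I]; then [z] is the sum of the
    [(1 (x) t) (a z)], all zero. *)
Lemma tensor_eq0_dense (M : lmodType R) (z : tensor M A) I :
  ideal_span I setT (1 : A) -> (forall a, I a -> a *: z = 0) -> z = 0.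
Proof.
elim/tensorW: z => s I1 Iz.
have -> : \pi_(tensor M A) s = \sum_(p <- s) pure_tensor p.1 (1 * p.2).
  by rewrite tensor_sum; apply: eq_bigr => p _; rewrite mul1r.
elim: I1 => [|a t w Ia _ _ IH].
  by rewrite big1 // => p _; rewrite mul0r pure_tensor0r.
(* [h] is multiplication by [t] on the second factor. *)
have [||||h hE _] := @tensor_universal _ M A (tensor M A)
    (fun m n => pure_tensor m (t * n)).
- by move=> m m' n; rewrite pure_tensorDl.
- by move=> m n n'; rewrite mulrDr pure_tensorDr.
- by move=> c m n; rewrite pure_tensorZl.
- by move=> c m n; rewrite -scalerAr pure_tensorZr.
transitivity (h (a *: \pi_(tensor M A) s) + \sum_(p <- s) pure_tensor p.1 (w * p.2)).
  rewrite linearZ /= tensor_sum raddf_sum scaler_sumr -big_split.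
  apply: eq_bigr => p _ /=.
  by rewrite mulrDl pure_tensorDr -scalerAl pure_tensorZr hE.
by rewrite Iz // linear0 IH addr0.
Qed.

(** Let [x] and [y] have the same image. For all [a] in a dense set, [a x = m (x) 1] and
    [a y = m' (x) 1] with [f m = f m'], hence [m = m']. So a dense set kills [x - y]. *)
Lemma colon_flat : flat A.
Proof.
move=> M M' f f_inj x y; elim/tensorW: x => s; elim/tensorW: y => t.
rewrite /= !tensor_mapE => eq_st.
pose fs (u : seq (M * A)) := [seq (f p.1, p.2) | p <- u].
have fsE u : \sum_(p <- u) (pure_tensor (f p.1) p.2 : tensor M' A) =
    \pi_(tensor M' A) (fs u).
  by rewrite tensor_sum big_map.
have fs_denoms u a : denoms u a -> denoms (fs u) a.
  by move=> ua _ /mapP[p /ua pa ->].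
have fs_numer u a : numer_sum a (fs u) = f (numer_sum a u).
  by rewrite /numer_sum big_map raddf_sum; apply: eq_bigr => p _; rewrite /= linearZ.
move: eq_st; rewrite !fsE => /tensor_piP/tens_eq_numer[J dJ JE].
apply/eqP; rewrite -subr_eq0; apply/eqP.
have dJst := denseI (denseI dJ (denoms_dense s)) (denoms_dense t).
apply: tensor_eq0_dense (proj2 dJst) _ => a [[Ja sa] ta].
rewrite scalerBr !numer_sum_pure //; apply/eqP; rewrite subr_eq0; apply/eqP.
congr pure_tensor; apply: f_inj.
by rewrite -!fs_numer JE //; apply: fs_denoms.
Qed.

Lemma colon_flat_epi : flat_epi A.
Proof. by split; [apply: colon_flat | apply: colon_ring_epi]. Qed.

End FlatEpi.

(** * Subalgebras of [S], and extended ideals computed inside [S] *)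

Section Intermediate.
Variables (R : comNzRingType) (S : comAlgType R).
Implicit Types (x y z : S) (T U : subalgClosed S) (A B : set S).

Definition subalg_set A : Prop :=
  [/\ A 1, forall a x y, A x -> A y -> A (a *: x + y) &
      forall x y, A x -> A y -> A (x * y)].

Lemma intermediateP A : intermediate S A <-> subalg_set A.
Proof.
split=> [[T ->]|[A1 AD AM]].
  by split=> [|a x y Tx Ty|x y Tx Ty] /=;
    rewrite ?rpred1 // ?rpredM ?rpredD ?rpredZ.
have Acl : GRing.subalg_closed (fun z : S => `[< A z >]).
  split=> [|a x y /asboolP Ax /asboolP Ay|x y /asboolP Ax /asboolP Ay];
    by apply/asboolP; auto.
pose T : subalgClosed S := HB.pack (fun z : S => `[< A z >])
  (GRing.isSubalgClosed.Build R S _ (GRing.subalg_closed_semi Acl)).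
exists T; apply/seteqP; split=> z; first by move=> Az; apply/asboolP.
by move/asboolP.
Qed.

Lemma base_sub T x : x \in base S -> x \in T.
Proof. by move=> /base_inP[a ->]; rewrite rpredZ ?rpred1. Qed.

Section Subalg.
Variable T : subalgClosed S.

Lemma in_alg_subalg_inj : injective (in_alg S) -> injective (in_alg (subalg T)).
Proof. by move=> S_inj a b /(congr1 val); rewrite !linearZ !rmorph1 => /S_inj. Qed.

Lemma colon_val (t : subalg T) : colon (val t) = colon t.
Proof.
apply/seteqP; split=> a; rewrite /colon /= => /base_inP[b ab]; apply/base_inP;
  exists b.
  by apply: val_inj; rewrite !linearZ rmorph1.
by have := congr1 val ab; rewrite !linearZ rmorph1.
Qed.

(** The right-hand side lives in [S], where different subalgebras can be compared. *)
Lemma ideal_span_val (I : set R) (z : subalg T) :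
  ideal_span I setT z <-> ideal_span I [set x | x \in T] (val z).
Proof.
split=> [|Iz].
  elim=> [|a t w Ia _ _ IH]; first by rewrite raddf0; left.
  by rewrite linearP; apply: ideal_span_cons => //; apply: valP.
have : exists2 w : subalg T, val w = val z & ideal_span I setT w.
  elim: Iz => [|a t w Ia Tt _ [v <- Iv]]; first by exists 0; [rewrite raddf0|left].
  exists (a *: (Sub t Tt : subalg T) + v); last exact: ideal_span_cons.
  by rewrite linearP.
by case=> w /val_inj ->.
Qed.

Lemma subalg_flat_epi_colon (t : S) : flat_epi (subalg T) -> t \in T ->
  ideal_span (colon t) [set x | x \in T] (1 : S).
Proof.
move=> T_epi Tt; have /ideal_span_val := flat_epi_colon (Sub t Tt : subalg T) T_epi.
by rewrite -colon_val rmorph1.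
Qed.

End Subalg.

(** * The subalgebras [R[x]] and the ideals [(R : x) + x (R : x)] *)

Lemma horner_algE x (p : {poly R}) : horner_alg x p = (map_poly (in_alg S) p).[x].
Proof. by []. Qed.

Lemma horner_algZ x a (p : {poly R}) : horner_alg x (a *: p) = a *: horner_alg x p.
Proof. by rewrite linearZ /= mulr_algl. Qed.

Lemma horner_alg_Xn x n : horner_alg x 'X^n = x ^+ n.
Proof. by rewrite rmorphXn /= horner_algX. Qed.

Lemma horner_alg_comp_Xn x n (p : {poly R}) :
  horner_alg (x ^+ n) p = horner_alg x (p \Po 'X^n).
Proof. by rewrite !horner_algE map_comp_poly map_polyXn horner_comp hornerXn. Qed.

Definition adjoin x : {pred S} :=
  fun z => `[< exists p : {poly R}, z = horner_alg x p >].

Lemma adjoinP x z : reflect (exists p : {poly R}, z = horner_alg x p) (z \in adjoin x).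
Proof. exact: asboolP. Qed.

Lemma adjoin_horner x p : horner_alg x p \in adjoin x.
Proof. by apply/adjoinP; exists p. Qed.

Lemma adjoin_id x : x \in adjoin x.
Proof. by rewrite -{1}(horner_algX x) adjoin_horner. Qed.

Lemma adjoin_subalg x : GRing.subalg_closed (adjoin x).
Proof.
split=> [|a _ _ /adjoinP[p ->] /adjoinP[q ->]|_ _ /adjoinP[p ->] /adjoinP[q ->]].
- by rewrite -(rmorph1 (horner_alg x)) adjoin_horner.
- by rewrite -horner_algZ -raddfD adjoin_horner.
- by rewrite -rmorphM adjoin_horner.
Qed.

HB.instance Definition _ x := GRing.isSubalgClosed.Build R S (adjoin x)
  (GRing.subalg_closed_semi (adjoin_subalg x)).

Lemma intermediate_adjoin x : intermediate S [set z | z \in adjoin x].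
Proof. by pose T : subalgClosed S := adjoin x; exists T. Qed.

Lemma adjoin_ideal_span x (I : set R) z : I 0 ->
    (forall a b, I b -> I (a * b)) -> (forall a b, I a -> I b -> I (a + b)) ->
    ideal_span I [set y | y \in adjoin x] z ->
  exists2 p : {poly R}, forall i, I p`_i & z = horner_alg x p.
Proof.
move=> I0 IM ID; elim=> [|a _ _ Ia /adjoinP[q ->] _ [p Ip ->]].
  by exists 0; rewrite ?rmorph0 // => i; rewrite coef0.
exists (a *: q + p); last by rewrite raddfD /= horner_algZ.
by move=> i; rewrite coefD coefZ; apply: ID => //; rewrite mulrC; apply: IM.
Qed.

(* The ideal [(R : x) + x (R : x)] of [R]. *)
Definition colon_sum x : set R :=
  [set r | exists a b : R, [/\ colon x a, colon x b & r%:A = a%:A + b *: x]].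

Lemma colonD x a b : colon x a -> colon x b -> colon x (a + b).
Proof. by rewrite /colon /= scalerDl; apply: rpredD. Qed.

Lemma colonN x a : colon x a -> colon x (- a).
Proof. by rewrite /colon /= scaleNr rpredN. Qed.

Lemma colon0 x : colon x 0.
Proof. by rewrite /colon /= scale0r rpred0. Qed.

Lemma colon_sumD x r s : colon_sum x r -> colon_sum x s -> colon_sum x (r + s).
Proof.
move=> [a [b [xa xb rE]]] [c [d [xc xd sE]]]; exists (a + c), (b + d).
by split; rewrite ?scalerDl ?rE ?sE; [exact: colonD | exact: colonD | rewrite addrACA].
Qed.

Lemma colon_sumN x r : colon_sum x r -> colon_sum x (- r).
Proof.
move=> [a [b [xa xb rE]]]; exists (- a), (- b).
by split; rewrite ?scaleNr ?rE; [exact: colonN | exact: colonN | rewrite opprD].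
Qed.

Lemma colon_sum_colon x a : colon x a -> colon_sum x a.
Proof. by move=> xa; exists a, 0; rewrite scale0r addr0; split=> //; apply: colon0. Qed.

Lemma colon_sum_mul x a r : colon x a -> a *: x = r%:A -> colon_sum x r.
Proof.
move=> xa axr; exists 0, a; rewrite scale0r add0r axr.
by split=> //; apply: colon0.
Qed.

Lemma colon_sum_ideal_span T x : x \in T -> colon_sum x 1 ->
  ideal_span (colon x) [set y | y \in T] (1 : S).
Proof.
move=> Tx [a [b [xa xb /esym]]]; rewrite scale1r => <-.
by apply: ideal_spanD; apply: ideal_span_mem => //=; rewrite rpred1.
Qed.

(** Because [(R : x) x] lies in [R], hence in [T]. In particular [(R : x) T = T] forces [x] into
    [T]. *)
Lemma ideal_span_colon T x z :
  ideal_span (colon x) [set y | y \in T] z -> z * x \in T.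
Proof.
elim=> [|a t w xa Tt _ IH]; first by rewrite mul0r rpred0.
by rewrite mulrDl rpredD // -scalerAl scalerAr rpredM // base_sub.
Qed.

(** * Pruefer extensions, integral closedness and the Delta property *)

Section Prufer.
Hypothesis S_inj : injective (in_alg S).

Lemma colon_sum_prufer : (forall x, colon_sum x 1) -> prufer S.
Proof.
move=> S1 T; apply: colon_flat_epi => [|t]; first exact: in_alg_subalg_inj.
apply/ideal_span_val; rewrite -colon_val rmorph1.
by apply: colon_sum_ideal_span => //; apply: valP.
Qed.

(* As [R[x] = (R : x) R[x]] and [(R : x) x] lies in [R], a bound on the degree
   of polynomial expressions in [x] can be lowered. *)
Lemma adjoin_degree_lower x m :
    ideal_span (colon x) [set y | y \in adjoin x] (1 : S) ->
    {in adjoin x, forall z,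
      exists2 p : {poly R}, (size p <= m.+2)%N & z = horner_alg x p} ->
  {in adjoin x, forall z,
    exists2 p : {poly R}, (size p <= m.+1)%N & z = horner_alg x p}.
Proof.
move=> x1 Hm z xz.
have : ideal_span (colon x) [set y | y \in adjoin x] z.
  by rewrite -[z]mulr1; apply: ideal_spanMl x1 => u xu; apply: rpredM.
elim=> [|a t w /base_inP[b ab] /Hm[p sp ->] _ [q sq ->]].
  by exists 0; rewrite ?size_poly0 ?rmorph0.
(* With [p = p0 + p1 X] and [a x = b] in [R], [a p(x) = a p0 + b p1(x)]: the factor [X] is
   absorbed. *)
exists (a *: take_poly 1 p + b *: drop_poly 1 p + q).
  rewrite (leq_trans (size_polyD _ _)) // geq_max sq andbT.
  rewrite (leq_trans (size_polyD _ _)) // geq_max.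
  rewrite !(leq_trans (size_scale_leq _ _)) //.
    by rewrite size_drop_poly subn1; case: (size p) sp.
  exact: leq_trans (size_take_poly _ _) _.
rewrite !raddfD /= !horner_algZ; congr (_ + _).
rewrite -{1}(poly_take_drop 1 p) raddfD /= rmorphM /= expr1 horner_algX scalerDr.
by rewrite scalerAr ab mulrC mulr_algl.
Qed.

(** Division by the monic equation of [x] bounds the degrees of the polynomials needed for [R[x]].
    Lowering the bound down to constants gives [R[x] = R]. *)
Lemma prufer_integrally_closed : prufer S -> integrally_closed S.
Proof.
move=> Spru x [q q_monic /rootP qx0].
have x1 := subalg_flat_epi_colon (Spru (adjoin x)) (adjoin_id x).
have Hq : {in adjoin x, forall z,
    exists2 p : {poly R}, (size p <= size q)%N & z = horner_alg x p}.
  move=> _ /adjoinP[p ->]; exists (Pdiv.Ring.rmodp p q).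
    by apply/ltnW/Pdiv.Ring.ltn_rmodpN0/monic_neq0.
  rewrite {1}(Pdiv.RingMonic.rdivp_eq q_monic p) raddfD /= rmorphM.
  by rewrite /= [horner_alg x q]qx0 mulr0 add0r.
have [m] : exists m, {in adjoin x, forall z,
    exists2 p : {poly R}, (size p <= m.+1)%N & z = horner_alg x p}.
  by exists (size q) => z /Hq[p sp ->]; exists p => //; apply: leqW.
elim: m => [/(_ x (adjoin_id x))[p /size1_polyC -> {1}->]|m IHm].
  by rewrite horner_algC base_alg.
by move=> /(adjoin_degree_lower x1)/IHm.
Qed.

Section IntegrallyClosed.
Hypothesis S_ic : integrally_closed S.

(* The equation multiplied by [l^n] is monic in [l x]. *)
Lemma lead_colon x n (c : nat -> R) :
  \sum_(i < n.+2) c i *: x ^+ i = 0 -> colon x (c n.+1).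
Proof.
move=> cx0; apply: S_ic.
set l := c n.+1.
exists ('X^(n.+1) + \poly_(i < n.+1) (c i * l ^+ (n - i))).
  apply/monicP; rewrite lead_coefDl ?lead_coefXn //.
  by rewrite size_polyXn ltnS size_poly.
apply/rootP; rewrite rmorphD /= map_polyXn hornerD hornerXn.
rewrite poly_def rmorph_sum /= horner_sum.
transitivity (l ^+ n *: \sum_(i < n.+2) c i *: x ^+ i); last by rewrite cx0 scaler0.
rewrite [in RHS]big_ord_recr /= scalerDr addrC scaler_sumr; congr (_ + _).
  apply: eq_bigr => i _.
  rewrite map_polyZ hornerZ /= map_polyXn hornerXn mulr_algl exprZn !scalerA.
  congr (_ *: _); rewrite -mulrA -exprD subnK; last by rewrite -ltnS.
  by rewrite mulrC.
by rewrite exprZn scalerA -exprSr.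
Qed.

(* With [l x = r] in [R], where [l] is the leading coefficient, the relation can
   be rewritten in lower degree: [l x^(n+1) + c x^n = (c + r) x^n]. *)
Lemma coef_colon_sum x n (c : nat -> R) : \sum_(i < n) c i *: x ^+ i = 0 ->
  forall i, (i < n)%N -> colon_sum x (c i).
Proof.
elim: n c => [//|[_ c|n IHn c cx0]].
  rewrite big_ord1 expr0 => c0 [|//] _.
  have -> : c 0 = 0 by apply: S_inj; rewrite /= c0 scale0r.
  exact/colon_sum_colon/colon0.
have xl := lead_colon cx0; have /base_inP[r lr] := xl.
pose d i := if i == n then c n + r else c i.
have dx0 : \sum_(i < n.+1) d i *: x ^+ i = 0.
  rewrite big_ord_recr /= /d eqxx -[RHS]cx0 !big_ord_recr /= -addrA.
  congr (_ + _).
    by apply: eq_bigr => i _; rewrite ltn_eqF.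
  by rewrite scalerDl exprS scalerAl lr mulr_algl.
have Hd := IHn d dx0.
move=> i; rewrite ltnS leq_eqVlt => /predU1P[->|]; first exact: colon_sum_colon.
rewrite ltnS leq_eqVlt => /predU1P[->|lt_in].
  have := Hd n (ltnSn n); rewrite /d eqxx => Hn.
  rewrite -[c n](addrK r); apply: colon_sumD => //; apply: colon_sumN.
  exact: colon_sum_mul xl lr.
by have := Hd i (ltnW lt_in); rewrite /d ltn_eqF.
Qed.

Lemma poly_coef_colon_sum x (p : {poly R}) : horner_alg x p = 0 ->
  forall i, colon_sum x p`_i.
Proof.
move=> px0 i; have [lt_ip|le_pi] := ltnP i (size p); last first.
  by rewrite nth_default //; apply/colon_sum_colon/colon0.
apply: (@coef_colon_sum x (size p) (nth 0 p)) lt_ip.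
rewrite -[RHS]px0 -[in RHS](coefK p) poly_def raddf_sum; apply: eq_bigr => j _.
by rewrite /= horner_algZ horner_alg_Xn.
Qed.

End IntegrallyClosed.

(** As [(R : x) R[x] = R[x]], there is [p] with coefficients in [(R : x)] and [p(x) = 1]. The
    relation [p - 1] has constant coefficient [p0 - 1], and [p0] is already in [(R : x)]. *)
Lemma prufer_colon_sum : prufer S -> forall x, colon_sum x 1.
Proof.
move=> Spru x; have S_ic := prufer_integrally_closed Spru.
have [||||p xp p1] := @adjoin_ideal_span x (colon x) 1.
- exact: colon0.
- by move=> a b; apply: colonM.
- exact: colonD.
- exact: subalg_flat_epi_colon (Spru (adjoin x)) (adjoin_id x).
have : colon_sum x (p - 1)`_0.
  by apply: poly_coef_colon_sum => //; rewrite raddfB /= rmorph1 -p1 subrr.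
rewrite coefB coef1 /= => /colon_sumN.
move/(colon_sumD (colon_sum_colon (xp 0))).
by rewrite opprB addrCA subrr addr0.
Qed.

(* [x^2 x^3 = p(x^2) + q(x^3)] is a relation in which [x^5] has coefficient 1. *)
Lemma delta_colon_sum : integrally_closed S -> delta_extension S ->
  forall x, colon_sum x 1.
Proof.
move=> S_ic Sdelta x.
have /intermediateP[_ _ mulTU] :=
  Sdelta _ _ (intermediate_adjoin (x ^+ 2)) (intermediate_adjoin (x ^+ 3)).
have [||_ /adjoinP[p ->] [_ /adjoinP[q ->] x5]] := mulTU (x ^+ 2) (x ^+ 3).
- by exists (x ^+ 2); [apply: adjoin_id | exists 0; rewrite ?addr0 //=; apply: rpred0].
- by exists 0; [apply: rpred0 | exists (x ^+ 3); rewrite ?add0r //; apply: adjoin_id].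
(* 5 is a multiple of neither 2 nor 3, so [X^5] does not occur in [p(X^2) + q(X^3)]. *)
have : colon_sum x ('X^5 - ((p \Po 'X^2) + (q \Po 'X^3)))`_5.
  apply: poly_coef_colon_sum => //.
  rewrite raddfB raddfD /= horner_alg_Xn -!horner_alg_comp_Xn x5 -exprD.
  by rewrite subrr.
by rewrite coefB coefXn coefD !coef_comp_poly_Xn // addr0 subr0.
Qed.

(* Where [y t = 1], either [y u = u / t] or its inverse lies in [R], so that [t u]
   is in [R t^2] or in [R u^2]. *)
Lemma prufer_delta : prufer S -> delta_extension S.
Proof.
move=> /prufer_colon_sum S1 _ _ [T ->] [U ->].
set TU := (X in intermediate S X).
have TUD a b : TU a -> TU b -> TU (a + b).
  move=> [t Tt [u Uu <-]] [t' Tt' [u' Uu' <-]].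
  exists (t + t'); first exact: rpredD.
  by exists (u + u'); [exact: rpredD | rewrite addrACA].
have TTU t : t \in T -> TU t.
  by move=> Tt; exists t => //; exists 0; [exact: rpred0 | rewrite addr0].
have UTU u : u \in U -> TU u.
  by move=> Uu; exists 0; [exact: rpred0 | exists u => //; rewrite add0r].
apply/intermediateP; split; first exact/TTU/rpred1.
  move=> a _ y [t Tt [u Uu <-]] TUy; apply: (TUD _ _ _ TUy).
  by rewrite scalerDr; apply: (TUD); [apply/TTU/rpredZ | apply/UTU/rpredZ].
have mulTU t u : t \in T -> u \in U -> TU (t * u).
  move=> Tt Uu.
  have [a [y [ta ty ay1]]] := S1 t.
  have [c [d [wc wd cd1]]] := S1 (y *: u).
  rewrite scale1r in ay1; rewrite scale1r in cd1.
  (* With [e, f, g, h] the images of [a, y, c, d], the elements [e t], [g f u] and [h (f t)^2] come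
     from [R]. So the three summands lie in [U], [T] and [U]. *)
  have tuE (e f g h : S) : 1 = e + f * t -> 1 = g + h * (f * u) ->
      t * u = e * t * u + (g * (f * u) * (t * t) + h * (f * t) * (f * t) * (u * u)).
    move=> ef1 gh1; transitivity ((e + f * t * (g + h * (f * u))) * (t * u)).
      by rewrite -gh1 mulr1 -ef1 mul1r.
    by ring.
  have := tuE a%:A y%:A c%:A d%:A; rewrite !mulr_algl => /(_ ay1 cd1) ->.
  apply: (TUD); first by apply/UTU/rpredM => //; apply: base_sub.
  apply: (TUD); first by apply/TTU/rpredM; [apply: base_sub | apply: rpredM].
  apply/UTU/rpredM; last exact: rpredM.
  by apply: base_sub; rewrite base_mul // rpredZ.
move=> _ _ [t Tt [u Uu <-]] [t' Tt' [u' Uu' <-]].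
rewrite mulrDl !mulrDr [u * t']mulrC.
apply: (TUD); apply: (TUD); [exact/TTU/rpredM | exact: (mulTU) | exact: (mulTU) |].
exact/UTU/rpredM.
Qed.

End Prufer.

End Intermediate.

(** * Finiteness conditions and chains of subalgebras *)

Lemma finite_powerset (T : Type) (A : set T) :
  finite_set A -> finite_set [set X | X `<=` A].
Proof.
case=> n /card_set_bijP[f [f_fun f_inj _]].
pose g (B : {set 'I_n}) : set T := [set x | A x /\ exists2 i, i \in B & f x = i].
apply: (@sub_finite_set _ _ (range g)); last exact/finite_image/finite_finset.
move=> X XA; exists [set i : 'I_n | `[< exists2 x, X x & f x = i >]]%SET => //.
apply/seteqP; split=> [x [Ax [i]]|x Xx].
  rewrite inE => /asboolP[y Xy <-] /f_inj -> //; first exact: mem_set.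
  exact/mem_set/XA.
split; first exact: XA.
exists (Ordinal (f_fun x (XA x Xx))) => //.
by rewrite inE; apply/asboolP; exists x.
Qed.

Section FiniteChains.
Variables (R : comNzRingType) (S : comAlgType R).
Hypothesis S_inj : injective (in_alg S).

Lemma fip_fcp : fip S -> fcp S.
Proof. by move=> Sfin C CS _; apply: sub_finite_set Sfin. Qed.

Lemma adjoin_exp (x : S) m n : (m %| n)%N ->
  {subset adjoin (x ^+ n) <= adjoin (x ^+ m)}.
Proof.
move=> /dvdnP[k ->] _ /adjoinP[p ->].
by rewrite mulnC exprM horner_alg_comp_Xn adjoin_horner.
Qed.

(* [R[x^(2^j)] = R[x^(2^k)]] with [j < k] gives a relation in which [x^(2^j)] has
   coefficient 1. *)
Lemma fcp_colon_sum : integrally_closed S -> fcp S -> forall x : S, colon_sum x 1.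
Proof.
move=> S_ic Sfcp x.
pose C k : set S := [set z | z \in adjoin (x ^+ (2 ^ k))].
have C_sub j k : (j <= k)%N -> C k `<=` C j.
  by move=> jk z; apply: adjoin_exp; apply: dvdn_exp2l.
suff [j [k [lt_jk Cjk]]] : exists j k, (j < k)%N /\ C j = C k.
  have : x ^+ (2 ^ j) \in adjoin (x ^+ (2 ^ k)).
    by have : C j (x ^+ (2 ^ j)) by [apply: adjoin_id]; rewrite Cjk.
  move=> /adjoinP[p]; rewrite horner_alg_comp_Xn => xp.
  have : colon_sum x ('X^(2 ^ j) - (p \Po 'X^(2 ^ k)))`_(2 ^ j).
    by apply: poly_coef_colon_sum => //; rewrite raddfB /= horner_alg_Xn -xp subrr.
  (* Since [j < k], [2^k] does not divide [2^j], so [p(X^(2^k))] has no term of degree [2^j]. *)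
  rewrite coefB coefXn eqxx coef_comp_poly_Xn ?expn_gt0 //.
  by rewrite dvdn_Pexp2l // leqNgt lt_jk subr0.
have : finite_set (range C).
  apply: Sfcp => [_ [k _ <-]|_ _ [j _ <-] [k _ <-]].
    exact: intermediate_adjoin.
  by case: (leqP j k) => [/C_sub|/ltnW/C_sub]; [right | left].
move=> Cfin; apply: contrapT => C_inj.
suff C_injective : injective C.
  move/finite_setPn: Cfin; apply.
  suff /card_eqPle[] : range C #= [set: nat] by [].
  by apply: inj_card_eq => j k _ _ /C_injective.
move=> j k Cjk; have [lt_jk|lt_kj|//] := ltngtP j k; case: C_inj.
  by exists j, k.
by exists k, j.
Qed.

End FiniteChains.

(** * Primes [P] containing [I] with [P T] different from [T] *)

Section AvoidingPrime.
Variables (R : comNzRingType) (S : comAlgType R) (T : subalgClosed S) (I : set R).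
Hypothesis I1 : ~ ideal_span I [set x | x \in T] (1 : S).

(** Adding [I] here, instead of asking that [A] contain it, makes the property hold for the union of
    the empty chain. *)
Let avoids (A : set R) := ~ ideal_span (A `|` I) [set x | x \in T] (1 : S).

(** An expression of 1 involves finitely many elements of the union of a chain, so it is already
    available over one member. *)
Lemma avoids_maximal : exists A, avoids A /\ forall B, A `<` B -> ~ avoids B.
Proof.
apply: Zorn_bigcup => F F_avoids F_total.
(* The empty set provides a member when the chain is empty, or when only elements of [I] occur. *)
pose G := F `|` [set set0].
have G_avoids X : G X -> avoids X by case=> [/F_avoids//|->]; rewrite /avoids set0U.
have G_total X Y : G X -> G Y -> X `<=` Y \/ Y `<=` X.
  move=> [FX|->] [FY|->]; [exact: F_total | right | left | left]; exact: sub0set.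
have G_span z : ideal_span ((\bigcup_(X in F) X) `|` I) [set x | x \in T] z ->
    exists2 X, G X & ideal_span (X `|` I) [set x | x \in T] z.
  elim=> [|a t w Ia Tt _ [X GX Xw]]; first by exists set0; [right | left].
  have [Y GY Ya] : exists2 Y, G Y & (Y `|` I) a.
    case: Ia => [[Y FY Ya]|Ia]; first by exists Y; left.
    by exists set0; [right | right].
  have [XY|YX] := G_total X Y GX GY.
    exists Y => //; apply: ideal_span_cons => //.
    by apply: ideal_spanS Xw; apply: setSU.
  exists X => //; apply: ideal_span_cons => //.
  by case: Ya => [/YX|]; [left | right].
by move=> /G_span[X /G_avoids].
Qed.

(** A maximal [A] with [A T] different from [T] is prime: if [u] and [v] are outside [A] and [u v]
    is in [A], then 1 lies in [(A + R u) T] and in [(A + R v) T], whose product is inside [A T]. *)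
Lemma avoiding_prime : exists P : prime_idealr R,
  (forall a, I a -> a \in P) /\
  ~ ideal_span [set a | a \in P] [set x | x \in T] (1 : S).
Proof.
have [A [A1 A_max]] := avoids_maximal.
have TM (t u : S) : t \in T -> u \in T -> t * u \in T by apply: rpredM.
have A_adj r : ~ A r -> ideal_span (r |` A `|` I) [set x | x \in T] (1 : S).
  move=> nAr; apply: contrapT; apply: A_max; split; first exact: subsetUr.
  by move=> /(_ r (or_introl erefl)).
(* By maximality [A] contains each [r] whose image lies in [A T + I T]; the inclusion of [I] and
   closure under linear combinations follow. *)
have A_span r : ideal_span (A `|` I) [set x | x \in T] (r%:A : S) -> A r.
  move=> Ar; apply: contrapT => /A_adj; apply: contra_not A1 => //.
  apply: ideal_span_bind => a t [[->|Aa] Tt|Ia Tt].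
  - rewrite -[r *: t]mulr_algl mulrC; apply: ideal_spanMl Ar => u; exact: TM.
  - by apply: ideal_span_mem => //; left.
  - by apply: ideal_span_mem => //; right.
have IA : I `<=` A.
  by move=> a Ia; apply: A_span; apply: ideal_span_mem; [right | apply: rpred1].
have AI : A `|` I = A by apply/seteqP; split=> [a [|/IA]|a] //; left.
have A0 : A 0 by apply: A_span; rewrite scale0r; left.
have AD a u v : A u -> A v -> A (a * u + v).
  move=> Au Av; apply: A_span; rewrite scalerDl mulrC -scalerA.
  apply: ideal_spanD; apply: ideal_span_mem; rewrite ?AI //= ?rpredZ ?rpred1 //.
have AM a u : A u -> A (a * u) by move=> Au; rewrite -[_ * _]addr0; apply: AD.
pose P : {pred R} := fun a => `[< A a >].
have P_ideal : idealr_closed P.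
  split=> [||a u v /asboolP Au /asboolP Av]; try by apply/asboolP; auto.
  apply/negP => /asboolP A_1; apply: A1; rewrite AI -[1]scale1r.
  by apply: ideal_span_mem => //; apply: rpred1.
have P_prime : prime_idealr_closed P.
  move=> u v /asboolP Auv; apply/orP; apply: contrapT => /not_orP[Pu Pv].
  have /A_adj u1 : ~ A u by move=> Au; apply: Pu; apply/asboolP.
  have /A_adj v1 : ~ A v by move=> Av; apply: Pv; apply/asboolP.
  apply: A1; rewrite AI -[1]mulr1; apply: ideal_spanM u1 v1 => // a b.
  rewrite -!setUA AI => -[->|Aa] [->|Ab] //; last exact: AM.
    exact: AM.
  by rewrite mulrC; apply: AM.
pose Q : prime_idealr R := HB.pack P (isIdealr.Build R P P_ideal)
  (isPrimeIdealrClosed.Build R P P_prime).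
exists Q; split=> [a /IA Aa|]; first exact/asboolP.
apply: contra_not A1; rewrite AI; apply: ideal_spanS => a; exact: asboolW.
Qed.

End AvoidingPrime.

(** * Subalgebras determined by primes of the support *)

Section FiniteSupport.
Variables (R : comNzRingType) (S : comAlgType R).

(** The class of [x / 1] is nonzero in the localization: [u] kills the class of [x] in [S / R] only
    if [u] is in [(R : x)], hence in [P]. *)
Lemma colon_supp (P : prime_idealr R) (x : S) :
  (forall a, colon x a -> a \in P) -> supp (ext_quot S) [set a | a \in P].
Proof.
move=> xP; exists P => //.
exists (loc_frac (\pi_(ext_quot S) x) (Sub 1 (one_notin P))).
move=> /eqmodP/asboolP[u uP]; rewrite /= !scale1r.
rewrite subr0 => u0; move: uP; rewrite xP //.
have : \pi_(ext_quot S) (u *: x) = \pi_(ext_quot S) 0.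
  by rewrite quotmod_pi0 -[RHS]u0; apply/esym/quotmod_scaleE.
by move=> /quotmod_piP; rewrite subr0.
Qed.

Definition expanding_supp (A : set S) : set (set R) :=
  [set Q | supp (ext_quot S) Q /\ ideal_span Q A (1 : S)].

(** If [z] is in [T] but not in [U], then [(R : z) U] differs from [U], and some prime [P]
    containing [(R : z)] has [P U] different from [U]. It lies in the support, while [P T] contains
    [(R : z) T = T]. *)
Lemma expanding_supp_sub (T U : subalgClosed S) : (forall x : S, colon_sum x 1) ->
    expanding_supp [set x | x \in T] `<=` expanding_supp [set x | x \in U] ->
  {subset T <= U}.
Proof.
move=> S1 TU z Tz; apply: contrapT => Uz.
have [|P [zP P1]] := @avoiding_prime R S U (colon z).
  by move=> /ideal_span_colon; rewrite mul1r.
have [|_ //] := TU [set a | a \in P].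
split; first exact: colon_supp zP.
exact: ideal_spanS zP _ (colon_sum_ideal_span Tz (S1 z)).
Qed.

(* [T] consists of the [z] with [(R : z) T = T], so it is determined by the primes
   [Q] in the support such that [Q T = T]. *)
Lemma finite_supp_fip : (forall x : S, colon_sum x 1) ->
  finite_set (supp (ext_quot S)) -> fip S.
Proof.
move=> S1 supp_fin; rewrite /fip.
have : finite_set (expanding_supp @` intermediate S).
  apply: (@sub_finite_set _ _ [set X | X `<=` supp (ext_quot S)]).
    by move=> _ [A _ <-] Q [].
  exact: finite_powerset.
rewrite (eq_finite_set (inj_card_eq _)) //.
move=> _ _ /set_mem[T ->] /set_mem[U ->] TU.
by apply/seteqP; split=> z; apply: expanding_supp_sub => //; rewrite TU.
Qed.

End FiniteSupport.

Theorem proposition4p1 (R : comNzRingType) (S : comAlgType R)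
    (hRS : injective (GRing.in_alg S)) :
  (prufer S <-> integrally_closed S /\ delta_extension S) /\
  (integrally_closed S ->
   finite_set (supp (ext_quot S)) ->
   (delta_extension S <-> fcp S) /\
   (delta_extension S <-> fip S) /\
   (fcp S <-> fip S)).
Proof.
split.
  split=> [Spru|[S_ic Sdelta]].
    by split; [apply: prufer_integrally_closed | apply: prufer_delta].
  exact/colon_sum_prufer/delta_colon_sum.
move=> S_ic supp_fin.
(* The equivalences follow from the cycle Delta, FIP, FCP, Delta. *)
have delta_fip : delta_extension S -> fip S.
  by move=> /delta_colon_sum S1; apply: finite_supp_fip => //; apply: S1.
have fcp_delta : fcp S -> delta_extension S.
  by move=> Sfcp; apply/prufer_delta/colon_sum_prufer/fcp_colon_sum.
have := @fip_fcp R S; tauto.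
Qed.
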